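(* If $G$ is a t.d.l.c.s.c. group and $G$ has an open solvable subgroup, then $G\in\mathscr{E}$.
   Context: A t.d.l.c.s.c. group is a totally disconnected locally compact second countable (Hausdorff) topological group. The class $\mathscr{E}$ of elementary groups is the smallest class of t.d.l.c.s.c. groups such that: (i) $\mathscr{E}$ contains all second countable profinite groups and all countable discrete groups; (ii) if $G$ is a t.d.l.c.s.c. group and $H\trianglelefteq G$ is a closed normal subgroup with $H\in\mathscr{E}$ and $G/H$ either profinite or discrete, then $G\in\mathscr{E}$; (iii) if $G$ is a t.d.l.c.s.c. group and $G=\bigcup_{i\in\mathbb{N}}O_i$ where $(O_i)_{i\in\mathbb{N}}$ is an $\subseteq$-increasing sequence of open subgroups of $G$ with $O_i\in\mathscr{E}$ for each $i$, then $G\in\mathscr{E}$. A topological group $G$ is solvable if its derived series of closed subgroups, $G^{(0)}:=G$, $G^{(n+1)}:=\overline{[G^{(n)},G^{(n)}]}$, reaches $\{1\}$ after finitely many steps. *)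

(* Defs.v *)
From HB Require Import structures.
From mathcomp Require Import all_boot.
From mathcomp Require Import all_classical topology.

Set Implicit Arguments.
Unset Strict Implicit.
Unset Printing Implicit Defensive.

Local Open Scope classical_set_scope.
Local Open Scope quotient_scope.
Local Open Scope group_scope.

#[short(type="preTopologicalGroupType")]
HB.structure Definition PreTopologicalGroup := {G of Topological G & Group G}.

HB.mixin Record PreTopologicalGroup_isTopologicalGroup G
    of PreTopologicalGroup G := {
  mulg_continuous : continuous (fun xy : G * G => xy.1 * xy.2);
  invg_continuous : continuous (fun x : G => x^-1)
}.

#[short(type="topologicalGroupType")]
HB.structure Definition TopologicalGroup :=
  {G of PreTopologicalGroup G & PreTopologicalGroup_isTopologicalGroup G}.

Section TopologicalGroupTheory.
Variable G : topologicalGroupType.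

Lemma cvg_mulg (T : Type) (F : set_system T) (f g : T -> G) (a b : G) :
  Filter F -> f @ F --> a -> g @ F --> b -> (fun t => f t * g t) @ F --> a * b.
Proof.
move=> FF; apply: (@continuous2_cvg _ _ _ _ _ _ _ _ (fun x y => x * y)).
exact: (mulg_continuous (a, b)).
Qed.

Lemma mulg_contr (a : G) : continuous (fun x : G => x * a).
Proof. by move=> x; apply: cvg_mulg; [exact: cvg_id|exact: cvg_cst]. Qed.

End TopologicalGroupTheory.

Record subgroup (G : groupType) := Subgroup {
  subgroup_set : set G;
  subgroup_closed : group_closed [in subgroup_set]
}.

Section SubgroupTheory.
Variables (G : groupType) (H : subgroup G).
Local Notation HS := (subgroup_set H).

Lemma subgroup1 : HS 1.
Proof. by have [/set_mem] := subgroup_closed H. Qed.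

Lemma subgroupF x y : HS x -> HS y -> HS (x / y).
Proof.
move=> Hx Hy; have [_ HF] := subgroup_closed H.
by apply/set_mem/HF; exact/mem_set.
Qed.

Lemma subgroupV x : HS x -> HS x^-1.
Proof. by move=> Hx; rewrite -[x^-1]mul1g; exact: subgroupF subgroup1 Hx. Qed.

Lemma subgroupM x y : HS x -> HS y -> HS (x * y).
Proof. by move=> Hx /subgroupV Hy; rewrite -[y]invgK; exact: subgroupF. Qed.

End SubgroupTheory.

(** A subgroup as a topological group, for the subspace topology. *)
Definition subgroup_type (G : groupType) (H : subgroup G) : Type :=
  set_type (subgroup_set H).

HB.instance Definition _ (G : groupType) (H : subgroup G) :=
  SubChoice.on (subgroup_type H).
HB.instance Definition _ (G : groupType) (H : subgroup G) :=
  SubChoice_isSubGroup.Build G [in subgroup_set H]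
    (subgroup_type H) (subgroup_closed H).
HB.instance Definition _ (G : topologicalGroupType) (H : subgroup G) :=
  Topological.copy (subgroup_type H) (set_type (subgroup_set H)).

Section SubgroupTopology.
Variables (G : topologicalGroupType) (H : subgroup G).

Local Lemma subgroup_val_continuous : continuous (val : subgroup_type H -> G).
Proof. exact: initial_continuous. Qed.

Local Lemma subgroup_mulg_continuous :
  continuous (fun xy : subgroup_type H * subgroup_type H => xy.1 * xy.2).
Proof.
apply: (@continuous_comp_initial _ _ G (val : subgroup_type H -> G)).
have -> : val \o (fun xy : subgroup_type H * subgroup_type H => xy.1 * xy.2) =
    (fun xy => val xy.1 * val xy.2) by [].
move=> -[x y]; apply: cvg_mulg.
- by apply: (cvg_comp _ _ cvg_fst); exact: subgroup_val_continuous.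
- by apply: (cvg_comp _ _ cvg_snd); exact: subgroup_val_continuous.
Qed.

Local Lemma subgroup_invg_continuous :
  continuous (fun x : subgroup_type H => x^-1).
Proof.
apply: (@continuous_comp_initial _ _ G (val : subgroup_type H -> G)).
have -> : val \o (fun x : subgroup_type H => x^-1) = (fun x => (val x)^-1).
  by [].
move=> x; apply: (cvg_comp _ _ (@subgroup_val_continuous x)).
exact: invg_continuous.
Qed.

HB.instance Definition _ :=
  PreTopologicalGroup_isTopologicalGroup.Build (subgroup_type H)
    subgroup_mulg_continuous subgroup_invg_continuous.

End SubgroupTopology.

Coercion subgroup_topologicalGroup (G : topologicalGroupType) (H : subgroup G) :
  topologicalGroupType := subgroup_type H.

Record normal_subgroup (G : groupType) := NormalSubgroup {
  normal_subgroup_group :> subgroup G;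
  normal_subgroupJ : forall x g : G,
    subgroup_set normal_subgroup_group x ->
    subgroup_set normal_subgroup_group (x ^ g)
}.

Section Cosets.
Variables (G : groupType) (N : normal_subgroup G).

Definition coset_rel : rel G := fun x y => x^-1 * y \in subgroup_set N.

Local Lemma coset_rel_refl : reflexive coset_rel.
Proof. by move=> x; rewrite /coset_rel mulVg; exact/mem_set/subgroup1. Qed.

Local Lemma coset_rel_sym : symmetric coset_rel.
Proof.
suff imp x y : coset_rel x y -> coset_rel y x.
  by move=> x y; apply/idP/idP; exact: imp.
by move=> /set_mem /subgroupV; rewrite invgM invgK => ?; exact/mem_set.
Qed.

Local Lemma coset_rel_trans : transitive coset_rel.
Proof.
move=> y x z /set_mem Nxy /set_mem Nyz; apply/mem_set.
by have := subgroupM Nxy Nyz; rewrite mulgA mulgK.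
Qed.

Canonical coset_equiv :=
  EquivRel coset_rel coset_rel_refl coset_rel_sym coset_rel_trans.

End Cosets.

(** The group G / N of left cosets of N, for the quotient topology. *)
Definition quotient_group_type (G : topologicalGroupType)
    (N : normal_subgroup G) : Type :=
  quotient_topology {eq_quot (coset_equiv N)}.

HB.instance Definition _ (G : topologicalGroupType) (N : normal_subgroup G) :=
  Topological.on (quotient_group_type N).
HB.instance Definition _ (G : topologicalGroupType) (N : normal_subgroup G) :=
  Choice.on (quotient_group_type N).
HB.instance Definition _ (G : topologicalGroupType) (N : normal_subgroup G) :=
  Quotient.on (quotient_group_type N).

Section QuotientGroup.
Variables (G : topologicalGroupType) (N : normal_subgroup G).
Local Notation Q := (quotient_group_type N).
Local Notation NS := (subgroup_set N).

Definition quotient_one : Q := \pi_Q 1.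
Definition quotient_mul (a b : Q) : Q := \pi_Q (repr a * repr b).
Definition quotient_inv (a : Q) : Q := \pi_Q (repr a)^-1.

Local Lemma pi_eqP (x y : G) : \pi_Q x = \pi_Q y <-> NS (x^-1 * y).
Proof.
split=> [/(@eqmodP _ (coset_equiv N))/set_mem //|Nxy].
by apply/(@eqmodP _ (coset_equiv N)); exact/mem_set.
Qed.

Local Lemma repr_pi (x : G) : NS (x^-1 * repr (\pi_Q x)).
Proof. by apply/pi_eqP; rewrite reprK. Qed.

Local Lemma pi_mulg (x y : G) :
  \pi_Q (x * y) = quotient_mul (\pi_Q x) (\pi_Q y).
Proof.
apply/pi_eqP; set x' := repr _; set y' := repr _.
have -> : (x * y)^-1 * (x' * y') = (x^-1 * x') ^ y * (y^-1 * y').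
  by rewrite /conjg invgM -!mulgA mulVKg.
by apply: subgroupM; [apply: normal_subgroupJ|]; exact: repr_pi.
Qed.

Local Lemma pi_invg (x : G) : \pi_Q x^-1 = quotient_inv (\pi_Q x).
Proof.
apply/pi_eqP; set x' := repr _.
have -> : x^-1^-1 * x'^-1 = ((x^-1 * x') ^ x^-1)^-1.
  by rewrite /conjg !invgM !invgK -!mulgA mulgV mulg1.
by apply/subgroupV/normal_subgroupJ/repr_pi.
Qed.

Local Lemma quotient_mulA : associative quotient_mul.
Proof.
elim/quotW=> x; elim/quotW=> y; elim/quotW=> z.
by rewrite -(pi_mulg y z) -(pi_mulg x y) -pi_mulg -pi_mulg mulgA.
Qed.

Local Lemma quotient_mul1 : left_id quotient_one quotient_mul.
Proof. by move=> a; rewrite -[a]reprK -pi_mulg mul1g. Qed.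

Local Lemma quotient_mulr1 : right_id quotient_one quotient_mul.
Proof. by move=> a; rewrite -[a]reprK -pi_mulg mulg1. Qed.

Local Lemma quotient_mulV : left_inverse quotient_one quotient_inv quotient_mul.
Proof. by move=> a; rewrite -[a]reprK -pi_invg -pi_mulg mulVg. Qed.

Local Lemma quotient_mulrV :
  right_inverse quotient_one quotient_inv quotient_mul.
Proof. by move=> a; rewrite -[a]reprK -pi_invg -pi_mulg mulgV. Qed.

HB.instance Definition _ := isGroup.Build Q
  quotient_mulA quotient_mul1 quotient_mulr1 quotient_mulV quotient_mulrV.

Local Lemma quotient_pi_continuous : continuous (\pi_Q : G -> Q).
Proof. exact: pi_continuous. Qed.

Local Lemma quotient_pi_open (U : set G) : open U -> open (\pi_Q @` U).
Proof.
move=> oU; rewrite /open /= /quotient_open.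
have -> : \pi_Q @^-1` (\pi_Q @` U) =
    \bigcup_(h in NS) ((fun x => x * h) @^-1` U).
  apply/seteqP; split=> [x [u Uu /esym/pi_eqP Nxu]|x [h Nh Uxh]].
    by exists (x^-1 * u) => //=; rewrite mulVKg.
  by exists (x * h) => //; apply/esym/pi_eqP; rewrite mulKg.
apply: bigcup_open => h _; apply: open_comp => // x _.
exact: mulg_contr.
Qed.

Local Lemma quotient_pi_nbhs (x : G) (U : set G) :
  nbhs x U -> nbhs (\pi_Q x) (\pi_Q @` U).
Proof.
rewrite !nbhsE => -[V [oV Vx] VU]; exists (\pi_Q @` V).
  by split; [exact: quotient_pi_open|exists x].
exact: image_subset.
Qed.

Local Lemma quotient_mulg_continuous :
  continuous (fun ab : Q * Q => ab.1 * ab.2).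
Proof.
move=> -[a b] W /=; rewrite -[a]reprK -[b]reprK.
set x := repr a; set y := repr b => Wxy.
have : nbhs (x * y) (\pi_Q @^-1` W).
  by apply: quotient_pi_continuous; rewrite pi_mulg.
move=> /(@mulg_continuous G (x, y))[[U V] /= [Ux Vy] UV].
exists (\pi_Q @` U, \pi_Q @` V); first by split; exact: quotient_pi_nbhs.
move=> -[_ _] /= [[u Uu <-] [v Vv <-]].
by have := UV (u, v) (conj Uu Vv); rewrite /= pi_mulg.
Qed.

Local Lemma quotient_invg_continuous : continuous (fun a : Q => a^-1).
Proof.
move=> a W /=; rewrite -[a]reprK; set x := repr a => Wx.
have : nbhs x^-1 (\pi_Q @^-1` W).
  by apply: quotient_pi_continuous; rewrite pi_invg.
move=> /(@invg_continuous G x)/quotient_pi_nbhs; apply: filterS.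
by move=> _ [u Wu <-]; move: Wu; rewrite /= pi_invg.
Qed.

HB.instance Definition _ :=
  PreTopologicalGroup_isTopologicalGroup.Build Q
    quotient_mulg_continuous quotient_invg_continuous.

End QuotientGroup.

Definition quotient_group (G : topologicalGroupType) (N : normal_subgroup G) :
  topologicalGroupType := quotient_group_type N.

Definition tdlcsc (G : topologicalGroupType) : Prop :=
  [/\ hausdorff_space G, totally_disconnected [set: G],
      locally_compact [set: G] & @second_countable G].

Definition profinite (G : topologicalGroupType) : Prop :=
  [/\ hausdorff_space G, totally_disconnected [set: G] & compact [set: G]].

Definition discrete_group (G : topologicalGroupType) : Prop :=
  forall A : set G, open A.

(** [profinite], [discrete_group] and [elementary] are invariant under
    topological isomorphism; no constructor imposes it. *)
Inductive elementary : topologicalGroupType -> Prop :=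
| elementary_profinite (G : topologicalGroupType) :
    profinite G -> @second_countable G -> elementary G
| elementary_discrete (G : topologicalGroupType) :
    discrete_group G -> countable [set: G] -> elementary G
| elementary_extension (G : topologicalGroupType) (N : normal_subgroup G) :
    tdlcsc G -> closed (subgroup_set N) -> elementary N ->
    profinite (quotient_group N) \/ discrete_group (quotient_group N) ->
    elementary G
| elementary_union (G : topologicalGroupType) (O : nat -> subgroup G) :
    tdlcsc G ->
    (forall i, open (subgroup_set (O i))) ->
    (forall i, subgroup_set (O i) `<=` subgroup_set (O i.+1)) ->
    \bigcup_i subgroup_set (O i) = [set: G] ->
    (forall i, elementary (O i)) ->
    elementary G.

(** The abstract subgroup generated by the commutators [~ x, y], x, y in A. *)
Definition commutator_subgroup (G : groupType) (A : set G) : set G :=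
  smallest (fun B : set G => group_closed [in B])
    [set [~ x, y] | x in A & y in A].

Fixpoint derived_series (G : topologicalGroupType) (n : nat) : set G :=
  if n is m.+1 then closure (commutator_subgroup (derived_series m))
  else [set: G].
Arguments derived_series : clear implicits.

Definition solvable_group (G : topologicalGroupType) : Prop :=
  exists n, derived_series G n = [set 1].

(* Main.v *)
(* Induct on the derived length n + 1 of a compact open subgroup U. Let
   d V n denote the n-th derived subgroup and C V the centralizer of d V n.
   The union D of the C V over all open subgroups V is normal in G and contains
   d U n, because d U n is abelian; let K be the closure of D.
   - The image of U in G / K is open with trivial n-th derived subgroup, so
     G / K is elementary by induction.
   - Each C V is elementary: modulo the center of C V, the trace of V is
     open and has trivial n-th derived subgroup, and abelian groups are
     compact-by-discrete.
   - K is elementary: along a base (V i) of open subgroups normalized by U,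
     the groups (C (V i)) (U meet K) are open, increase to K, and are compact
     modulo C (V i).
   Hence G is elementary, since an extension of elementary groups is elementary;
   this is proved by induction on the construction of the quotient. *)
From HB Require Import structures.
Require Import Defs.
From mathcomp Require Import all_boot.
From mathcomp Require Import all_classical topology.

Set Implicit Arguments.
Unset Strict Implicit.
Unset Printing Implicit Defensive.

Local Open Scope classical_set_scope.
Local Open Scope quotient_scope.
Local Open Scope group_scope.

(** * Subgroups and derived series *)

Section Morphisms.
Variables (G H : groupType) (f : G -> H).
Hypothesis fM : {morph f : x y / x * y}.

Lemma morph_one : f 1 = 1.
Proof. by apply: (@mulgI _ (f 1)); rewrite -fM !mulg1. Qed.

Lemma morph_inv x : f x^-1 = (f x)^-1.
Proof. by apply: (@mulgI _ (f x)); rewrite -fM !mulgV morph_one. Qed.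

Lemma morph_div x y : f (x / y) = f x / f y.
Proof. by rewrite fM morph_inv. Qed.

Lemma morph_conj x y : f (x ^ y) = f x ^ f y.
Proof. by rewrite /conjg !fM morph_inv. Qed.

Lemma morph_comm x y : f [~ x, y] = [~ f x, f y].
Proof. by rewrite /commg fM morph_conj morph_inv. Qed.

End Morphisms.

Section SubgroupConstructions.
Variable G : groupType.
Implicit Types H K : subgroup G.

Lemma group_closedP (S : set G) :
  group_closed [in S] <-> S 1 /\ (forall x y, S x -> S y -> S (x / y)).
Proof.
split=> [[/set_mem S1 SF]|[S1 SF]].
  by split=> // x y Sx Sy; apply/set_mem/SF; exact/mem_set.
by split=> [|x y /set_mem Sx /set_mem Sy]; apply/mem_set; last exact: SF.
Qed.

Definition mk_subgroup (S : set G) (S1 : S 1)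
    (SF : forall x y, S x -> S y -> S (x / y)) : subgroup G :=
  Subgroup ((group_closedP S).2 (conj S1 SF)).

Lemma subgroupJ H x y : subgroup_set H x -> subgroup_set H y ->
  subgroup_set H (x ^ y).
Proof.
by move=> Hx Hy; apply: subgroupM; [exact: subgroupV|exact: subgroupM].
Qed.

Lemma subgroupMl H x y : subgroup_set H x ->
  subgroup_set H (x * y) <-> subgroup_set H y.
Proof.
move=> Hx; split=> [Hxy|]; last exact: subgroupM.
by rewrite -(mulKg x y); apply: subgroupM Hxy; exact: subgroupV.
Qed.

Definition subgroupI H K : subgroup G :=
  @mk_subgroup (subgroup_set H `&` subgroup_set K)
    (conj (subgroup1 H) (subgroup1 K))
    (fun x y Hx Hy => conj (subgroupF Hx.1 Hy.1) (subgroupF Hx.2 Hy.2)).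

Definition centralizer (A : set G) : subgroup G.
Proof.
apply: (@mk_subgroup [set x | forall a, A a -> commute a x]).
- by move=> a _; rewrite /commute mulg1 mul1g.
- move=> x y cx cy a Aa; apply: commuteM; first exact: cx.
  by apply: commuteV; exact: cy.
Defined.

End SubgroupConstructions.

Section SubgroupImages.
Variables (G H : groupType) (f : G -> H).
Hypothesis fM : {morph f : x y / x * y}.

Lemma preimage_subgroup_proof (K : subgroup H) :
  group_closed [in f @^-1` subgroup_set K].
Proof.
apply/group_closedP; split=> [|x y Kx Ky] /=.
  by rewrite (morph_one fM); exact: subgroup1.
by rewrite (morph_div fM); exact: subgroupF.
Qed.
Definition preimage_subgroup K := Subgroup (preimage_subgroup_proof K).

Lemma image_subgroup_proof (K : subgroup G) :
  group_closed [in f @` subgroup_set K].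
Proof.
apply/group_closedP; split=> [|_ _ [x Kx <-] [y Ky <-]].
  by exists 1; [exact: subgroup1|exact: morph_one].
by exists (x / y); [exact: subgroupF|exact: morph_div].
Qed.
Definition image_subgroup K := Subgroup (image_subgroup_proof K).

Lemma preimage_normalJ (N : normal_subgroup H) x g :
  subgroup_set (preimage_subgroup N) x ->
  subgroup_set (preimage_subgroup N) (x ^ g).
Proof. by rewrite /= (morph_conj fM); exact: normal_subgroupJ. Qed.
Definition preimage_normal N := NormalSubgroup (@preimage_normalJ N).

End SubgroupImages.

Section DerivedSets.

Lemma commutator_subgroup_group (G : groupType) (A : set G) :
  group_closed [in commutator_subgroup A].
Proof.
apply/group_closedP; split=> [S [/group_closedP[S1 _] _] //|x y Cx Cy S SA].
have [/group_closedP[_ SF] _] := SA.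
by apply: SF; [exact: Cx|exact: Cy].
Qed.

Lemma commutator_subgroup_commg (G : groupType) (A : set G) x y :
  A x -> A y -> commutator_subgroup A [~ x, y].
Proof. by move=> Ax Ay S [_]; apply; exists x => //; exists y. Qed.

Lemma commutator_subgroup_min (G : groupType) (A : set G) (S : subgroup G) :
  (forall x y, A x -> A y -> subgroup_set S [~ x, y]) ->
  commutator_subgroup A `<=` subgroup_set S.
Proof.
move=> AS x; apply; split; first exact: subgroup_closed.
by move=> _ [a Aa [b Ab <-]]; exact: AS.
Qed.

(* No closures are taken: in a Hausdorff group the series of closed derived
   subgroups and the abstract one reach the trivial group simultaneously. *)
Definition derived_set (G : groupType) (A : set G) (n : nat) : set G :=
  iter n (@commutator_subgroup G) A.

Lemma derived_set_morph (G H : groupType) (f : G -> H) (A : set G) (B : set H)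
    n : {morph f : x y / x * y} -> A `<=` f @^-1` B ->
  derived_set A n `<=` f @^-1` derived_set B n.
Proof.
move=> fM AB; elim: n => //= n IHn.
apply: (@commutator_subgroup_min _ _
  (preimage_subgroup fM (Subgroup (@commutator_subgroup_group _ _)))).
move=> x y Ax Ay /=; rewrite (morph_comm fM).
by apply: commutator_subgroup_commg; exact: IHn.
Qed.

Lemma derived_setS (G : groupType) (A B : set G) n :
  A `<=` B -> derived_set A n `<=` derived_set B n.
Proof. by move=> AB; exact: (@derived_set_morph _ _ id). Qed.

(** Every commutator of images is the image of a commutator, so elements of the derived sets of an
    image lift. For a quotient map, the derived set of the image is therefore trivial as soon as the
    one upstairs lies in the kernel. *)
Lemma derived_set_image (G H : groupType) (f : G -> H) (A : set G) n :
  {morph f : x y / x * y} ->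
  derived_set (f @` A) n `<=` f @` derived_set A n.
Proof.
move=> fM; elim: n => //= n IHn.
apply: (@commutator_subgroup_min _ _
  (image_subgroup fM (Subgroup (@commutator_subgroup_group _ _)))).
move=> x y /IHn[a Aa <-] /IHn[b Ab <-] /=.
exists [~ a, b]; last exact: morph_comm.
exact: commutator_subgroup_commg.
Qed.

Lemma derived_set_derived_series (G : topologicalGroupType) n :
  derived_set [set: G] n `<=` derived_series G n.
Proof.
elim: n => //= n IHn; apply: subset_trans (@subset_closure _ _).
by have := @derived_setS G _ _ 1 IHn.
Qed.

(** The abstract derived sets of the topological group [U] lie inside its closed derived series, and
    [val] carries them into [G]. Dropping closures here avoids comparing closures taken in [U] with
    closures taken in [G]. *)
Lemma solvable_derived_set (G : topologicalGroupType) (U : subgroup G) :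
  solvable_group U -> exists n, derived_set (subgroup_set U) n `<=` [set 1].
Proof.
move=> [n Un]; exists n => x.
have -> : subgroup_set U = (val : U -> G) @` [set: U].
  apply/seteqP; split=> [y Uy|_ [y _ <-]]; last exact: set_valP.
  by exists (exist _ y (mem_set Uy)).
move=> /(@derived_set_image _ _ _ _ _ (@valM _ _ _))[y].
by move=> /derived_set_derived_series; rewrite Un => -> <-; exact: val1.
Qed.

End DerivedSets.

(** * Closed embeddings *)

Lemma locally_compactP (X : topologicalType) : locally_compact [set: X] <->
  forall x : X, exists K, [/\ nbhs x K, compact K & closed K].
Proof.
split=> [lcX x|lcX x _].
  have [K Kx [cK clK]] := lcX x I; exists K; split=> //.
  by move: Kx; rewrite /within /=; apply: (@filterS _ (nbhs x)) => y; exact.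
have [K [Kx cK clK]] := lcX x; exists K; last by [].
by move: Kx; rewrite /within /=; apply: (@filterS _ (nbhs x)) => y.
Qed.

Section Embeddings.
Variables (X Y : topologicalType) (f : X -> Y).
Hypotheses (fc : continuous f) (fI : injective f).

Lemma injective_hausdorff : hausdorff_space Y -> hausdorff_space X.
Proof.
move=> hY p q clpq; apply/fI/hY => A B /fc Ap /fc Bq.
by have [x [Ax Bx]] := clpq _ _ Ap Bq; exists (f x).
Qed.

Lemma injective_totally_disconnected :
  totally_disconnected [set: Y] -> totally_disconnected [set: X].
Proof.
move=> tdY x _; apply/seteqP; split=> [y|_ ->]; last first.
  exact: connected_component_refl.
move=> [C [Cx _ cC] Cy]; apply: fI.
suff : connected_component [set: Y] (f x) (f y) by rewrite tdY.
exists (f @` C); last exact: imageP.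
split=> //.
by apply: connected_continuous_connected => //; exact: continuous_subspaceT.
Qed.

Hypothesis f_initial :
  forall U, open U -> exists2 V, open V & U = f @^-1` V.

Lemma initial_second_countable : @second_countable Y -> @second_countable X.
Proof.
move=> [B cB [Bo Bb]]; exists [set f @^-1` V | V in B].
  exact: (card_le_trans (card_image_le _ _)).
split=> [_ [V BV <-]|x U]; first by apply: open_comp => //; exact: Bo.
rewrite nbhsE => -[W [oW Wx] WU]; have [V oV WV] := f_initial oW.
have /Bb[C [BC Cfx] CV] : nbhs (f x) V.
  by apply: open_nbhs_nbhs; split=> //; move: Wx; rewrite WV.
exists (f @^-1` C); first by split=> //; exists C.
by apply: subset_trans WU => y Cy; rewrite WV; exact: CV.
Qed.

Hypothesis f_closed : closed (range f).

(** A filter on the preimage pushes forward to a filter on [K]. Its cluster point lies in the range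
    because the range is closed, and clustering pulls back because [X] carries the initial
    topology. *)
Lemma preimage_compact K : compact K -> compact (f @^-1` K).
Proof.
move=> cK F PF FK.
have [y [Ky cly]] := cK (f @ F) _ FK.
have [x _ fx] : range f y.
  apply: f_closed => B By; apply: cly By => /=.
  by apply: (@filterS _ F _ setT) filterT => z _; exists z.
exists x; split; first by rewrite /= fx.
move=> A B FA; rewrite nbhsE => -[W [oW Wx] WB]; have [V oV WV] := f_initial oW.
have Vy : nbhs y V.
  by apply: open_nbhs_nbhs; split=> //; rewrite -fx; move: Wx; rewrite WV.
have fFA : (f @ F) (f @` A).
  by apply: (@filterS _ F _ A) FA => a Aa; exists a.
have [_ [[a Aa <-] Va]] := cly _ _ fFA Vy.
by exists a; split=> //; apply: WB; rewrite WV.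
Qed.

Lemma closed_embedding_locally_compact :
  locally_compact [set: Y] -> locally_compact [set: X].
Proof.
move=> /locally_compactP lcY; apply/locally_compactP => x.
have [K [Kx cK clK]] := lcY (f x); exists (f @^-1` K); split.
- exact: fc.
- exact: preimage_compact.
- exact: preimage_closed.
Qed.

End Embeddings.

(** * Compact open sets and subgroups *)

(** Otherwise the traces on [L] of the members of [D] generate a proper filter, and a cluster point
    of it in [L] lies in every closed member. Stability under binary intersection reduces the usual
    finite subfamily to a single set. *)
Lemma compact_bigcap_closed (T : topologicalType) (D : set (set T))
    (L : set T) :
  D !=set0 -> (forall A B, D A -> D B -> D (A `&` B)) ->
  (forall A, D A -> closed A) -> compact L ->
  L `&` \bigcap_(A in D) A = set0 -> exists2 A, D A & L `&` A = set0.
Proof.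
move=> [A0 DA0] DI Dcl cL L0; apply: contrapT => noA.
have LA A : D A -> L `&` A !=set0.
  by move=> DA; apply/set0P/eqP => LA0; apply: noA; exists A.
pose F := filter_from D (fun A => L `&` A).
have PF : ProperFilter F.
  apply: filter_from_proper; last exact: LA.
  apply: filter_from_filter; first by exists A0.
  by move=> A B DA DB; exists (A `&` B); [exact: DI|rewrite setIACA setIid].
have [|p [Lp clp]] := cL F PF.
  by exists A0 => // x [].
have : (L `&` \bigcap_(A in D) A) p.
  split=> // A DA; apply: (Dcl A DA) => B Bp.
  have FA : F A by exists A => // x [].
  exact: clp FA Bp.
by rewrite L0.
Qed.

(** The quasi-component of [x] in a compact neighbourhood [K] is connected, hence equal to [{x}]. By
    compactness some relatively clopen subset of [K] containing [x] then avoids the boundary of [K],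
    which makes it open in [T]. *)
Lemma totally_disconnected_compact_open (T : topologicalType) (x : T) N :
  hausdorff_space T -> totally_disconnected [set: T] ->
  locally_compact [set: T] -> nbhs x N ->
  exists X, [/\ compact X, open X, X x & X `<=` N].
Proof.
move=> hT tdT /locally_compactP lcT Nx.
have [K' [K'x cK' clK']] := lcT x.
(* The closure of [M] must lie in the interior of [K'], and not only in [N], so that normality can
   be applied inside [K'] below. *)
have [M Mx MN] : filter_from (nbhs x) closure (N `&` K'°).
  apply: (compact_regular hT cK' K'x); apply: filterI => //.
  exact: nbhs_interior.
pose K := closure M; have clK : closed K by exact: closed_closure.
have KK' : K `<=` K'° by move=> y /MN[].
have cK : compact K.
  by apply: subclosed_compact cK' _ => // y /KK' /interior_subset.
have Kx : nbhs x K by apply: filterS Mx; exact: subset_closure.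
(* [D] consists of the relatively clopen subsets of [K] containing [x]; their intersection [Q] is
   the quasi-component of [x] in [K]. *)
pose D := [set C : set T |
  [/\ C x, closed C & exists2 O, open O & C = K `&` O]].
have DK : D K.
  split=> //; first exact: nbhs_singleton.
  by exists setT; [exact: openT|rewrite setIT].
have DI A B : D A -> D B -> D (A `&` B).
  move=> [Ax clA [O oO AO]] [Bx clB [P oP BP]]; split; first by [].
    exact: closedI.
  by exists (O `&` P); [exact: openI|rewrite AO BP setIACA setIid].
have Dcl A : D A -> closed A by case.
pose Q := \bigcap_(C in D) C.
have QK : Q `<=` K by move=> y; exact.
have Qx : Q x by move=> C [].
have clQ : closed Q by exact: closed_bigI.
(* In a compact space quasi-components are connected. *)
have Qconn : connected Q.
  apply: contrapT => /connectedPn[E [E0 QE [E1 E2]]].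
  have EQ b : E b `<=` Q by rewrite QE; case: b => y ?; [right|left].
  have clE b : closed (E b).
    move=> y clEy; have : Q y by apply: clQ; exact: closureS clEy.
    rewrite QE; case: b clEy => clEy [] // Ey; exfalso.
      by have : set0 y by rewrite -E2.
    by have : set0 y by rewrite -E1.
  have E12 b y : E b y -> ~ E (~~ b) y.
    case: b => /= Ey Ey'.
      by have : set0 y; [rewrite -E2; split=> //; exact: subset_closure|].
    by have : set0 y; [rewrite -E1; split=> //; exact: subset_closure|].
  have [b Ebx] : exists b, E b x.
    by move: Qx; rewrite QE => -[]; [exists false|exists true].
  have QE' y : Q y -> E b y \/ E (~~ b) y.
    by rewrite QE; case: (b) => -[]; [right|left|left|right].
  (* [E b] is the half of the separation that contains [x]. Normality yields an open [O] around it
     whose closure misses the other half. *)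
  have EN : set_nbhs (E b) (~` E (~~ b)).
    move=> y Ey; apply: open_nbhs_nbhs.
    by split; [exact: closed_openC|exact: E12].
  have EK' : E b `<=` K'° by move=> y /EQ/QK/KK'.
  have [U EU UE] := compact_normal_local hT cK' EK' (clE b) EN.
  move: EU => /set_nbhsP[O [oO EO OU]].
  (* The compact set [closure U] minus [O], cut down to [K], misses [Q], so some [C] in [D] misses
     it too. Then [C] meets [O] and [closure U] in the same set, which is therefore clopen in [K]
     and contains [Q]. This puts the other half inside [O], a contradiction. *)
  have [C DC LC] : exists2 C, D C & (K `&` closure U `\` O) `&` C = set0.
    apply: compact_bigcap_closed => //; first by exists K.
      rewrite setDE; apply: compact_closedI; last exact: open_closedC.
      by apply: compact_closedI => //; exact: closed_closure.
    apply/seteqP; split=> // y [[[Ky Uy] Oy] /QE'[/EO //|Ey]].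
    exact: UE Uy Ey.
  have [Cx clC [P oP CP]] := DC.
  have CU : C `&` O = C `&` closure U.
    apply/seteqP; split=> y [Cy]; first by move=> /OU/subset_closure.
    move=> Uy; split=> //; apply: contrapT => Oy.
    suff : set0 y by [].
    by rewrite -LC; do 3?split=> //; move: Cy; rewrite CP => -[].
  have DCO : D (C `&` O).
    split; first by split=> //; exact: EO.
      by rewrite CU; apply: closedI => //; exact: closed_closure.
    by exists (P `&` O); [exact: openI|rewrite CP setIA].
  have [z Ez] := E0 (~~ b).
  have /OU/subset_closure/UE : O z by have [] := EQ _ _ Ez _ DCO.
  exact.
have Q1 : Q `<=` [set x].
  by rewrite -(tdT x I) => y Qy; exists Q.
(* The same compactness argument, applied to the boundary of [K]. *)
have [C DC LC] : exists2 C, D C & (K `\` K°) `&` C = set0.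
  apply: compact_bigcap_closed => //; first by exists K.
    rewrite setDE; apply: compact_closedI => //.
    by apply: open_closedC; exact: open_interior.
  by apply/seteqP; split=> // y [[Ky Ky'] /Q1 yx]; apply: Ky'; rewrite yx.
have [Cx clC [O oO CO]] := DC.
have CK : C `<=` K by rewrite CO => y [].
have CKi : C `<=` K°.
  move=> y Cy; apply: contrapT => Ky; suff : set0 y by [].
  by rewrite -LC; split=> //; split=> //; exact: CK.
exists C; split=> //.
- exact: subclosed_compact clC cK CK.
- have -> : C = K° `&` O.
    apply/seteqP; split=> y; last by rewrite CO => -[/interior_subset].
    by move=> Cy; split; [exact: CKi|move: Cy; rewrite CO => -[]].
  by apply: openI => //; exact: open_interior.
- by move=> y /CK/MN[].
Qed.

Section TopologicalGroups.
Variable G : topologicalGroupType.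
Implicit Types H : subgroup G.

Lemma mulg_contl (a : G) : continuous (fun x : G => a * x).
Proof. by move=> x; apply: cvg_mulg; [exact: cvg_cst|exact: cvg_id]. Qed.

Lemma cvg_invg (T : Type) (F : set_system T) (f : T -> G) (a : G) :
  Filter F -> f @ F --> a -> (fun t => (f t)^-1) @ F --> a^-1.
Proof. by move=> FF fa; apply: cvg_comp fa _; exact: invg_continuous. Qed.

Lemma conjg_continuous : continuous (fun xy : G * G => xy.1 ^ xy.2).
Proof.
move=> -[x y]; apply: cvg_mulg; first by apply: cvg_invg; exact: cvg_snd.
by apply: cvg_mulg; [exact: cvg_fst|exact: cvg_snd].
Qed.

Lemma divg_continuous : continuous (fun xy : G * G => xy.1 / xy.2).
Proof.
move=> -[x y]; apply: cvg_mulg; first exact: cvg_fst.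
by apply: cvg_invg; exact: cvg_snd.
Qed.

Lemma conjg_cont (g : G) : continuous (fun x : G => x ^ g).
Proof.
move=> x; apply: cvg_mulg; first exact: cvg_cst.
exact: mulg_contr.
Qed.

Lemma commg_cont (g : G) : continuous (fun x : G => [~ g, x]).
Proof.
move=> x; apply: cvg_mulg; first exact: cvg_cst.
apply: cvg_mulg; first exact: invg_continuous.
exact: mulg_contl.
Qed.

Lemma open_subgroup_nbhs H : nbhs (1 : G) (subgroup_set H) ->
  open (subgroup_set H).
Proof.
move=> H1; rewrite openE => x Hx.
have : nbhs (x^-1 * x) (subgroup_set H) by rewrite mulVg.
move=> /(@mulg_contl x^-1 x); apply: (@filterS _ (nbhs x)) => y /=.
by move=> /subgroupMl; apply; exact: subgroupV.
Qed.

Lemma open_subgroup_sub H (U : set G) : open U -> U 1 ->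
  U `<=` subgroup_set H -> open (subgroup_set H).
Proof.
by move=> oU U1 UH; apply: open_subgroup_nbhs; rewrite nbhsE; exists U.
Qed.

Lemma open_subgroup_closed H : open (subgroup_set H) ->
  closed (subgroup_set H).
Proof.
move=> oH x clx.
have : nbhs (x^-1 * x) (subgroup_set H).
  by rewrite mulVg; apply: open_nbhs_nbhs; split=> //; exact: subgroup1.
move=> /(@mulg_contl x^-1 x)/clx[y [Hy /= Hxy]].
rewrite -[x]invgK; apply: subgroupV; rewrite -(mulgK y x^-1).
exact: subgroupF.
Qed.

Lemma closure_subgroup_proof H : group_closed [in closure (subgroup_set H)].
Proof.
apply/group_closedP; split; first exact/subset_closure/subgroup1.
move=> x y clx cly B.
move=> /(@divg_continuous (x, y))[[P Q] /= [/clx[a [Ha Pa]]]].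
move=> /cly[b [Hb Qb]] PQ.
exists (a / b); split; first exact: subgroupF.
exact: (PQ (a, b)).
Qed.
Definition closure_subgroup H := Subgroup (closure_subgroup_proof H).

Hypothesis hG : hausdorff_space G.

Lemma closed_1 : closed [set (1 : G)].
Proof. exact/accessible_closed_set1/hausdorff_accessible. Qed.

Lemma closed_centralizer (A : set G) : closed (subgroup_set (centralizer A)).
Proof.
have -> : subgroup_set (centralizer A) =
    \bigcap_(a in A) ((fun x => [~ a, x]) @^-1` [set 1]).
  apply/seteqP; split=> x cx a Aa; first by apply/eqP/commgP; exact: cx.
  by apply/commgP/eqP; exact: cx.
apply: closed_bigI => a _; apply: preimage_closed closed_1 => // x _.
exact: commg_cont.
Qed.

End TopologicalGroups.

Section VanDantzig.
Variable G : topologicalGroupType.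

(** [S] is the stabilizer of [X] under right translation; asking for both [h] and its inverse makes
    it a group. It lies in [X] because [X] contains 1. *)
Lemma compact_open_stabilizer (X : set G) : compact X -> open X -> X 1 ->
  exists H : subgroup G, open (subgroup_set H) /\ subgroup_set H `<=` X.
Proof.
move=> cX oX X1.
pose S := [set h : G | forall x, X x -> X (x * h) /\ X (x / h)].
have S1 : S 1 by move=> x Xx; rewrite invg1 mulg1.
have SF x y : S x -> S y -> S (x / y).
  move=> Sx Sy a Xa; split; first by rewrite mulgA; exact: (Sy _ (Sx _ Xa).1).2.
  by rewrite invgF mulgA; exact: (Sx _ (Sy _ Xa).1).2.
exists (mk_subgroup S1 SF); split; last first.
  by move=> h /(_ 1 X1)[]; rewrite mul1g.
apply: open_subgroup_nbhs => /=.
(* Compactness of [X] turns neighbourhoods of 1 chosen for each point [x] into one that works for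
   all of [X]. *)
have /compact_near_coveringP/(_ _ (nbhs (1 : G))
  (fun h x => X (x * h) /\ X (x / h))) := cX; apply.
move=> x Xx; near_simpl.
have XX : nbhs x X by exact: open_nbhs_nbhs.
apply: filterI.
- have := @mulg_continuous G (x, 1) X; apply.
  by rewrite /= mulg1.
- have := @divg_continuous G (x, 1) X; apply.
  by rewrite /= divg1.
Qed.

Theorem van_dantzig (N : set G) : tdlcsc G -> nbhs (1 : G) N ->
  exists H : subgroup G, [/\ open (subgroup_set H), compact (subgroup_set H) &
    subgroup_set H `<=` N].
Proof.
move=> [hG tdG lcG _] N1.
have [X [cX oX X1 XN]] := totally_disconnected_compact_open hG tdG lcG N1.
have [H [oH HX]] := compact_open_stabilizer cX oX X1.
exists H; split=> //; last exact: subset_trans XN.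
by apply: subclosed_compact HX => //; exact: open_subgroup_closed.
Qed.

(** [S] is the intersection of the conjugates of [V] by elements of [U]. Although the family may be
    infinite, compactness of [U] provides one neighbourhood of 1 contained in all of them. *)
Lemma open_normal_core (U V : subgroup G) : compact (subgroup_set U) ->
  open (subgroup_set V) ->
  exists W : subgroup G, [/\ open (subgroup_set W),
    subgroup_set W `<=` subgroup_set V &
    forall x u, subgroup_set U u -> subgroup_set W x -> subgroup_set W (x ^ u)].
Proof.
move=> cU oV.
pose S := [set x : G | forall u, subgroup_set U u -> subgroup_set V (x ^ u)].
have S1 : S 1 by move=> u _; rewrite conj1g; exact: subgroup1.
have SF x y : S x -> S y -> S (x / y).
  move=> Sx Sy u Uu; rewrite conjMg conjVg.
  by apply: subgroupF; [exact: Sx|exact: Sy].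
exists (mk_subgroup S1 SF); split.
- apply: open_subgroup_nbhs => /=.
  have /compact_near_coveringP/(_ _ (nbhs (1 : G))
    (fun x u => subgroup_set V (x ^ u))) := cU; apply.
  move=> u Uu; near_simpl.
  have V1 : nbhs (1 ^ u) (subgroup_set V).
    by rewrite conj1g; apply: open_nbhs_nbhs; split=> //; exact: subgroup1.
  have [[P Q] /= [P1 Qu] PQ] := @conjg_continuous G (1, u) _ V1.
  by exists (Q, P) => // -[a b] [Qa Pb]; exact: (PQ (b, a)).
- by move=> x Sx; rewrite -[x]conjg1; apply: Sx; exact: subgroup1.
- by move=> x u Uu Sx v Uv; rewrite -conjgM; apply: Sx; exact: subgroupM.
Qed.

End VanDantzig.

(** Meant for quotient groups, since total disconnectedness does not pass to quotients of spaces.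
    Cosets of open subgroups are clopen, and they separate points once small open subgroups
    exist. *)
Lemma open_subgroup_base_tdlc (G : topologicalGroupType) :
  closed [set (1 : G)] ->
  (forall N, nbhs (1 : G) N ->
    exists H : subgroup G, open (subgroup_set H) /\ subgroup_set H `<=` N) ->
  hausdorff_space G /\ totally_disconnected [set: G].
Proof.
move=> cl1 base.
have zd : zero_dimensional G.
  move=> x y xy.
  (* This neighbourhood omits exactly the inverse of [x^-1 * y]. A subgroup [H] inside it then omits
     [x^-1 * y] as well, so the coset [x H] does not contain [y]. *)
  have : nbhs (1 : G) ((fun z => x^-1 * y * z) @^-1` ~` [set 1]).
    apply: mulg_contl; apply: open_nbhs_nbhs; split; first exact: closed_openC.
    by rewrite mulg1 => /mulg1_eq; rewrite invgK => /eqP; rewrite (negbTE xy).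
  move=> /base[H [oH HN]].
  exists ((fun z => x^-1 * z) @^-1` subgroup_set H); split.
  - split; first by apply: open_comp => // z _; exact: mulg_contl.
    apply: preimage_closed; last exact: open_subgroup_closed.
    by move=> z _; exact: mulg_contl.
  - by rewrite /= mulVg; exact: subgroup1.
  - by move=> /= /subgroupV/HN; rewrite /= mulgV; exact.
split; last exact: zero_dimension_totally_disconnected.
rewrite open_hausdorff => x y /zd[U [[oU clU] Ux Uy]].
exists (U, ~` U); first by split; exact/mem_set.
by split=> //=; [exact: closed_openC|rewrite setICr].
Qed.

(** * Subgroups, quotients and isomorphisms *)

Section SubgroupTopology.
Variables (G : topologicalGroupType) (H : subgroup G).

Lemma subgroup_valM : {morph (val : H -> G) : x y / x * y}.
Proof. exact: valM. Qed.

Lemma subgroup_val_continuous : continuous (val : H -> G).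
Proof. exact: initial_continuous. Qed.

Lemma subgroup_valP (x : H) : subgroup_set H (val x).
Proof. exact: set_valP. Qed.

Definition subgroup_in x (Hx : subgroup_set H x) : H := exist _ x (mem_set Hx).

Lemma subgroup_val_initial (U : set H) : open U ->
  exists2 V, open V & U = val @^-1` V.
Proof. by move=> [V oV <-]; exists V. Qed.

Lemma subgroup_range_val : range (val : H -> G) = subgroup_set H.
Proof.
apply/seteqP; split=> [_ [x _ <-]|x Hx]; first exact: subgroup_valP.
by exists (subgroup_in Hx).
Qed.

Lemma subgroup_compact : compact (subgroup_set H) -> hausdorff_space G ->
  compact [set: H].
Proof.
move=> cH hG; have <- : (val : H -> G) @^-1` subgroup_set H = [set: H].
  by apply/seteqP; split=> // x _; exact: subgroup_valP.
apply: preimage_compact => //; first exact: subgroup_val_initial.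
by rewrite subgroup_range_val; exact: compact_closed.
Qed.

Lemma tdlcsc_closed_subgroup : closed (subgroup_set H) -> tdlcsc G -> tdlcsc H.
Proof.
move=> clH [hG tdG lcG scG].
have vc := subgroup_val_continuous; have vi := subgroup_val_initial.
have vI : injective (val : H -> G) by exact: val_inj.
split.
- exact: injective_hausdorff hG.
- exact: injective_totally_disconnected tdG.
- apply: (closed_embedding_locally_compact vc) => //.
  by rewrite subgroup_range_val.
- exact: initial_second_countable scG.
Qed.

End SubgroupTopology.

Section Quotients.
Variables (G : topologicalGroupType) (N : normal_subgroup G).
Local Notation Q := (quotient_group N).
Local Notation pi := (\pi_(quotient_group_type N) : G -> Q).

Lemma quotient_piM : {morph pi : x y / x * y}.
Proof. exact: Defs.pi_mulg. Qed.

Lemma quotient_pi_surj (a : Q) : exists x, pi x = a.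
Proof. by exists (repr a); rewrite reprK. Qed.

Lemma quotient_pi_eq1 x : pi x = 1 <-> subgroup_set N x.
Proof.
rewrite -(morph_one quotient_piM); split=> [/esym/Defs.pi_eqP|Nx].
  by rewrite invg1 mul1g.
by apply/esym/Defs.pi_eqP; rewrite invg1 mul1g.
Qed.

Lemma quotient_pi_cont : continuous pi.
Proof. exact: Defs.quotient_pi_continuous. Qed.

Lemma quotient_second_countable : @second_countable G -> @second_countable Q.
Proof.
move=> [B cB [Bo Bb]]; exists [set pi @` V | V in B].
  exact: (card_le_trans (card_image_le _ _)).
split=> [_ [V BV <-]|a U]; first by apply: Defs.quotient_pi_open; exact: Bo.
have [x <-] := quotient_pi_surj a => /quotient_pi_cont/Bb[V [BV Vx] VU].
exists (pi @` V); first by split; [exists V|exists x].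
by move=> _ [y /VU Uy <-].
Qed.

Lemma tdlcsc_quotient : closed (subgroup_set N) -> tdlcsc G -> tdlcsc Q.
Proof.
move=> clN tG; have [hG tdG lcG scG] := tG.
have base W : nbhs (1 : Q) W -> exists H : subgroup Q,
    open (subgroup_set H) /\ subgroup_set H `<=` W.
  rewrite -(morph_one quotient_piM) => /quotient_pi_cont/(van_dantzig tG).
  move=> [V [oV _ VW]]; exists (image_subgroup quotient_piM V).
  by split; [exact: Defs.quotient_pi_open|move=> _ [x /VW Wx <-]].
have [|hQ tdQ] := open_subgroup_base_tdlc _ base.
  (* The trivial subgroup of the quotient is closed because its preimage is [N]. *)
  rewrite -openC /open/= /quotient_open /= -/(open _) openC.
  by congr (closed _) : clN; apply/seteqP; split=> x /quotient_pi_eq1.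
split=> //; last exact: quotient_second_countable.
apply/locally_compactP => a; have [x <-] := quotient_pi_surj a.
have /locally_compactP/(_ x)[K [Kx cK _]] := lcG.
have cpK : compact (pi @` K).
  apply: continuous_compact => //; apply: continuous_subspaceT.
  exact: quotient_pi_cont.
exists (pi @` K); split=> //; last exact: compact_closed.
exact: Defs.quotient_pi_nbhs.
Qed.

End Quotients.

Definition topgroup_iso (G H : topologicalGroupType) : Prop :=
  exists (f : G -> H) (g : H -> G), [/\ {morph f : x y / x * y},
    continuous f, continuous g, cancel f g & cancel g f].

Lemma topgroup_iso_sym (G H : topologicalGroupType) :
  topgroup_iso G H -> topgroup_iso H G.
Proof.
move=> [f [g [fM fc gc fK gK]]]; exists g, f; split=> // x y.
by rewrite -[in LHS](gK x) -[in LHS](gK y) -fM fK.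
Qed.

Section IsoTransfer.
Variables (G H : topologicalGroupType) (iGH : topgroup_iso G H).

Lemma iso_embedding : exists f : H -> G, [/\ continuous f, injective f,
  forall U, open U -> exists2 V, open V & U = f @^-1` V & range f = setT].
Proof.
have [f [g [fM fc gc fK gK]]] := iGH; exists g; split=> //.
- exact: can_inj gK.
- move=> U oU; exists (f @^-1` U); first exact: open_comp.
  by apply/seteqP; split=> x /=; rewrite gK.
- by apply/seteqP; split=> // x _; exists (f x).
Qed.

Lemma tdlcsc_iso : tdlcsc G -> tdlcsc H.
Proof.
have [f [fc fI fi fT]] := iso_embedding; move=> [hG tdG lcG scG]; split.
- exact: injective_hausdorff hG.
- exact: injective_totally_disconnected tdG.
- apply: (closed_embedding_locally_compact fc) => //.
  by rewrite fT; exact: closedT.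
- exact: initial_second_countable scG.
Qed.

Lemma second_countable_iso : @second_countable G -> @second_countable H.
Proof.
have [f [fc fI fi fT]] := iso_embedding.
exact: initial_second_countable.
Qed.

Lemma profinite_iso : profinite G -> profinite H.
Proof.
have [f [fc fI fi fT]] := iso_embedding; move=> [hG tdG cG]; split.
- exact: injective_hausdorff hG.
- exact: injective_totally_disconnected tdG.
- by apply: (preimage_compact fi) cG; rewrite fT; exact: closedT.
Qed.

Lemma discrete_iso : discrete_group G -> discrete_group H.
Proof.
have [f [fc fI fi fT]] := iso_embedding => dG A.
have -> : A = f @^-1` (f @` A).
  by apply/seteqP; split=> [x Ax|x [y Ay /fI <-]] //; exists x.
by apply: open_comp => //; exact: dG.
Qed.

End IsoTransfer.

(** [f] is constant on cosets of [N], so it may be evaluated on representatives. Openness of [f]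
    gives continuity of the inverse. *)
Lemma first_isomorphism (G Q : topologicalGroupType) (N : normal_subgroup G)
    (f : G -> Q) : {morph f : x y / x * y} -> continuous f ->
  (forall U, open U -> open (f @` U)) -> (forall a, exists x, f x = a) ->
  (forall x, f x = 1 <-> subgroup_set N x) -> topgroup_iso (quotient_group N) Q.
Proof.
move=> fM fc fo fs fN.
have fpi x : f (repr (\pi_(quotient_group_type N) x)) = f x.
  have /fN := Defs.repr_pi N x; rewrite fM (morph_inv fM).
  by move=> /mulg1_eq; rewrite invgK.
have [g gK] := choice fs.
exists (fun a => f (repr a)), (fun b => \pi_(quotient_group_type N) (g b)).
split.
- move=> a b; have [[x <-] [y <-]] := (quotient_pi_surj a, quotient_pi_surj b).
  by rewrite -quotient_piM !fpi fM.
- apply/quotient_continuous.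
  have -> : (fun a => f (repr a)) \o \pi_(quotient_group_type N) = f.
    by apply/funext => x; exact: fpi.
  by [].
- apply/continuousP => A oA.
  have -> : (fun b => \pi_(quotient_group_type N) (g b)) @^-1` A =
      f @` (\pi_(quotient_group_type N) @^-1` A).
    apply/seteqP; split=> [b Ab|_ [x Ax <-]] /=; first by exists (g b).
    suff -> : \pi_(quotient_group_type N) (g (f x)) = \pi x by [].
    by apply/esym/Defs.pi_eqP/fN; rewrite fM (morph_inv fM) gK mulVg.
  by apply: fo; apply: open_comp oA => x _; exact: quotient_pi_cont.
- move=> a; have [x <-] := quotient_pi_surj a; rewrite fpi.
  by apply/esym/Defs.pi_eqP/fN; rewrite fM (morph_inv fM) gK mulVg.
- by move=> b; rewrite fpi.
Qed.

(** Since [f] is only assumed to be a topological embedding, this covers both restrictions of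
    isomorphisms and the inclusion of a subgroup. *)
Lemma restrict_iso (G G' : topologicalGroupType) (H : subgroup G)
    (H' : subgroup G') (f : G -> G') :
  {morph f : x y / x * y} -> continuous f -> injective f ->
  (forall U, open U -> exists2 V, open V & U = f @^-1` V) ->
  f @` subgroup_set H = subgroup_set H' -> topgroup_iso H H'.
Proof.
move=> fM fc fI fi fH.
have fHH' (x : H) : subgroup_set H' (f (val x)).
  by rewrite -fH; exists (val x) => //; exact: subgroup_valP.
have /choice[g gP] : forall y : H', exists x : H, f (val x) = val y.
  move=> y; have [x Hx fx] : (f @` subgroup_set H) (val y).
    by rewrite fH; exact: subgroup_valP.
  by exists (subgroup_in Hx).
exists (fun x => subgroup_in (fHH' x)), g; split.
- by move=> x y; apply: val_inj; rewrite /= fM.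
- apply: continuous_comp_initial => x.
  have vc : {for x, continuous (val : H -> G)}.
    exact: subgroup_val_continuous.
  exact: (continuous_comp vc (fc _)).
- apply: continuous_comp_initial; apply/continuousP => U /fi[V oV ->].
  have -> : (val \o g) @^-1` (f @^-1` V) = val @^-1` V.
    by apply/seteqP; split=> y /=; rewrite gP.
  by apply: open_comp oV => x _; exact: subgroup_val_continuous.
- by move=> x; apply/val_inj/fI; rewrite gP.
- by move=> y; apply/val_inj; rewrite /= gP.
Qed.

(** * Closure properties of elementary groups *)

Lemma profinite_or_discrete_iso (G H : topologicalGroupType) :
  topgroup_iso G H -> profinite G \/ discrete_group G ->
  profinite H \/ discrete_group H.
Proof.
move=> iGH [pG|dG]; first by left; exact: profinite_iso pG.
by right; exact: discrete_iso dG.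
Qed.

(** Identifies a subgroup of the group [H] with the same set of elements taken as a subgroup of [G];
    the two are distinct topological groups as types. *)
Lemma restrict_sub_iso (G : topologicalGroupType) (H : subgroup G)
    (K : subgroup H) (K' : subgroup G) :
  (forall x : H, subgroup_set K x <-> subgroup_set K' (val x)) ->
  subgroup_set K' `<=` subgroup_set H -> topgroup_iso K K'.
Proof.
move=> KK' K'H; apply: (@restrict_iso _ _ _ _ (val : H -> G)).
- exact: subgroup_valM.
- exact: subgroup_val_continuous.
- exact: val_inj.
- exact: subgroup_val_initial.
- apply/seteqP; split=> [_ [x /KK' Kx <-] //|x K'x].
  by exists (subgroup_in (K'H x K'x)) => //; exact/KK'.
Qed.

(** Induction on the construction of [G]: each constructor's data is pulled back along the inverse
    isomorphism [g]. *)
Lemma elementary_iso (G H : topologicalGroupType) :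
  topgroup_iso G H -> elementary G -> elementary H.
Proof.
move=> iGH eG; elim: eG H iGH => {G}
  [G pG scG|G dG cG|G N tG clN eN IHN qN|G O tG oO incO covO eO IHO] H iGH.
- by apply: elementary_profinite;
    [exact: profinite_iso pG|exact: second_countable_iso scG].
- apply: elementary_discrete; first exact: discrete_iso dG.
  have [f [g [_ _ _ _ gK]]] := iGH.
  have -> : [set: H] = f @` [set: G].
    by apply/seteqP; split=> // y _; exists (g y).
  exact: (card_le_trans (card_image_le _ _)).
- have tH := tdlcsc_iso iGH tG.
  have [f [g [fM fc gc fK gK]]] := iGH.
  have gM : {morph g : x y / x * y}.
    by move=> x y; rewrite -[in LHS](gK x) -[in LHS](gK y) -fM fK.
  apply: (@elementary_extension _ (preimage_normal gM N)) => //=.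
  + exact: preimage_closed.
  + apply: IHN; apply: (restrict_iso fM fc (can_inj fK)) => [U oU|].
      exists (g @^-1` U); first exact: open_comp.
      by apply/seteqP; split=> x /=; rewrite fK.
    apply/seteqP; split=> [_ [x Nx <-] /=|y Ny]; first by rewrite fK.
    by exists (g y).
  + apply: profinite_or_discrete_iso qN; apply: topgroup_iso_sym.
    apply: (@first_isomorphism _ _ _ (\pi_(quotient_group_type N) \o g)).
    * by move=> x y /=; rewrite gM quotient_piM.
    * move=> x; apply: continuous_comp; first exact: gc.
      exact: quotient_pi_cont.
    * move=> U oU.
      suff -> : (\pi_(quotient_group_type N) \o g) @` U =
          \pi_(quotient_group_type N) @` (f @^-1` U).
        by apply: Defs.quotient_pi_open; exact: open_comp.
      apply/seteqP; split=> [_ [x Ux <-]|_ [x Ux <-]].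
        by exists (g x) => //=; rewrite gK.
      by exists (f x) => //=; rewrite fK.
    * move=> a; have [x <-] := quotient_pi_surj a.
      by exists (f x); rewrite /= fK.
    * by move=> x; exact: quotient_pi_eq1.
- have tH := tdlcsc_iso iGH tG.
  have [f [g [fM fc gc fK gK]]] := iGH.
  have gM : {morph g : x y / x * y}.
    by move=> x y; rewrite -[in LHS](gK x) -[in LHS](gK y) -fM fK.
  apply: (@elementary_union _ (fun i => preimage_subgroup gM (O i))) => //=.
  + by move=> i; exact: open_comp.
  + by move=> i x; exact: incO.
  + apply/seteqP; split=> // x _.
    by have : [set: G] (g x) by []; rewrite -covO => -[i _ Ox]; exists i.
  + move=> i; apply: (IHO i).
    apply: (restrict_iso fM fc (can_inj fK)) => [U oU|].
      exists (g @^-1` U); first exact: open_comp.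
      by apply/seteqP; split=> x /=; rewrite fK.
    apply/seteqP; split=> [_ [x Nx <-] /=|y Ny]; first by rewrite fK.
    by exists (g y).
Qed.

(** Restricting to the full preimage of [M] preserves openness, because the image of the trace of
    [V] on that preimage is the trace on [M] of the image of [V]. *)
Lemma open_map_restrict (G Q : topologicalGroupType) (f : G -> Q)
    (fM : {morph f : x y / x * y}) (M : subgroup Q) :
  continuous f -> (forall U, open U -> open (f @` U)) ->
  (forall a, exists x, f x = a) ->
  exists h : preimage_subgroup fM M -> M, [/\ {morph h : x y / x * y},
    continuous h, forall U, open U -> open (h @` U),
    forall a, exists x, h x = a & forall x, val (h x) = f (val x)].
Proof.
move=> fc fo fs; set L := preimage_subgroup fM M.
have LM (x : L) : subgroup_set M (f (val x)) by have := subgroup_valP x.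
exists (fun x => subgroup_in (LM x)); split=> //.
- by move=> x y; apply: val_inj; rewrite /= fM.
- apply: continuous_comp_initial => x.
  have vc : {for x, continuous (val : L -> G)}.
    exact: subgroup_val_continuous.
  exact: (continuous_comp vc (fc _)).
- move=> _ [V oV <-]; exists (f @` V); first exact: fo.
  apply/seteqP; split=> [a /= [x Vx fx]|_ [x Vx <-]]; last by exists (val x).
  have Lx : subgroup_set L x by rewrite /= fx; exact: subgroup_valP.
  by exists (subgroup_in Lx) => //; apply: val_inj.
- move=> a; have [x fx] := fs (val a).
  have Lx : subgroup_set L x by rewrite /= fx; exact: subgroup_valP.
  by exists (subgroup_in Lx); apply: val_inj.
Qed.

(** Induction on the construction of [Q]. Allowing any open surjection instead of the quotient map
    lets the induction hypothesis apply to the restrictions of [f] over subgroups of [Q]. *)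
Lemma elementary_extension_map (G Q : topologicalGroupType)
    (N : normal_subgroup G) (f : G -> Q) :
  elementary Q -> tdlcsc G -> {morph f : x y / x * y} -> continuous f ->
  (forall U, open U -> open (f @` U)) -> (forall a, exists x, f x = a) ->
  (forall x, f x = 1 <-> subgroup_set N x) -> closed (subgroup_set N) ->
  elementary N -> elementary G.
Proof.
move=> eQ; elim: eQ G N f => {Q} [Q pQ _|Q dQ _|Q M tQ clM eM IHM qM|
  Q O tQ oO incO covO eO IHO] G N f tG fM fc fo fs fN clN eN.
- apply: (elementary_extension tG clN eN); left.
  apply: profinite_iso pQ; apply: topgroup_iso_sym.
  exact: first_isomorphism fN.
- apply: (elementary_extension tG clN eN); right.
  apply: discrete_iso dQ; apply: topgroup_iso_sym.
  exact: first_isomorphism fN.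
- pose L := preimage_normal fM M.
  have clL : closed (subgroup_set L) by exact: preimage_closed.
  have [h [hM hc ho hs hf]] := open_map_restrict fM M fc fo fs.
  (* The kernel [N] seen inside [L]; it is the kernel of the restriction [h]. *)
  pose NL := preimage_normal (@subgroup_valM _ L) N.
  apply: (@elementary_extension _ L) => //.
    apply: (IHM L NL h) => //.
    + exact: tdlcsc_closed_subgroup.
    + move=> x; rewrite /= -fN -hf; split=> [-> //|h1].
      by apply: val_inj; rewrite h1.
    + by apply: preimage_closed => // x _; exact: subgroup_val_continuous.
    + apply: elementary_iso eN; apply/topgroup_iso_sym/restrict_sub_iso => //.
      by move=> x /fN fx1; rewrite /= fx1; exact: subgroup1.
  (* The quotient of [G] by [L] is isomorphic to that of [Q] by [M]. *)
  apply: profinite_or_discrete_iso qM; apply: topgroup_iso_sym.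
  apply: (@first_isomorphism _ _ _ (\pi_(quotient_group_type M) \o f)).
  + by move=> x y /=; rewrite fM quotient_piM.
  + move=> x; apply: continuous_comp; first exact: fc.
    exact: quotient_pi_cont.
  + by move=> U oU; rewrite -image_comp; apply/Defs.quotient_pi_open/fo.
  + move=> a; have [b <-] := quotient_pi_surj a; have [x <-] := fs b.
    by exists x.
  + by move=> x; exact: quotient_pi_eq1.
- apply: (@elementary_union _ (fun i => preimage_subgroup fM (O i))) => //=.
  + by move=> i; exact: open_comp.
  + by move=> i x; exact: incO.
  + apply/seteqP; split=> // x _.
    by have : [set: Q] (f x) by []; rewrite -covO => -[i _ Ox]; exists i.
  + move=> i; have [h [hM hc ho hs hf]] := open_map_restrict fM (O i) fc fo fs.
    set L := preimage_subgroup fM (O i).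
    pose NL := preimage_normal (@subgroup_valM _ L) N.
    apply: (IHO i L NL h) => //.
    * apply: tdlcsc_closed_subgroup tG; apply: open_subgroup_closed.
      exact: open_comp.
    * move=> x; rewrite /= -fN -hf; split=> [-> //|h1].
      by apply: val_inj; rewrite h1.
    * by apply: preimage_closed => // x _; exact: subgroup_val_continuous.
    * apply: elementary_iso eN; apply/topgroup_iso_sym/restrict_sub_iso => //.
      by move=> x /fN fx1; rewrite /= fx1; exact: subgroup1.
Qed.

Lemma elementary_extension_quotient (G : topologicalGroupType)
    (N : normal_subgroup G) : tdlcsc G -> closed (subgroup_set N) ->
  elementary N -> elementary (quotient_group N) -> elementary G.
Proof.
move=> tG clN eN eQ.
apply: (@elementary_extension_map _ _ N (\pi_(quotient_group_type N)) eQ) => //.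
- exact: quotient_piM.
- exact: quotient_pi_cont.
- exact: Defs.quotient_pi_open.
- exact: quotient_pi_surj.
- exact: quotient_pi_eq1.
Qed.

(** * Groups with an open solvable subgroup *)

Lemma discrete_quotient (G : topologicalGroupType) (N : normal_subgroup G) :
  open (subgroup_set N) -> discrete_group (quotient_group N).
Proof.
move=> oN A; rewrite /open /= /quotient_open openE => x Ax.
have : nbhs (x^-1 * x) (subgroup_set N).
  by rewrite mulVg; apply: open_nbhs_nbhs; split=> //; exact: subgroup1.
move=> /(@mulg_contl _ x^-1 x); apply: (@filterS _ (nbhs x)) => y /=.
by move=> /Defs.pi_eqP xy; rewrite /preimage /= -xy.
Qed.

Lemma elementary_compact_subgroup (G : topologicalGroupType) (H : subgroup G) :
  tdlcsc G -> compact (subgroup_set H) -> elementary H.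
Proof.
move=> tG cH; have hG : hausdorff_space G by case: tG.
have [hH tdH _ scH] := tdlcsc_closed_subgroup (compact_closed hG cH) tG.
by apply: elementary_profinite => //; split=> //; exact: subgroup_compact.
Qed.

Lemma elementary_abelian (G : topologicalGroupType) :
  tdlcsc G -> (forall x y : G, commute x y) -> elementary G.
Proof.
move=> tG cG; have [V [oV cV _]] := van_dantzig tG filterT.
have VJ x g : subgroup_set V x -> subgroup_set V (x ^ g).
  by rewrite /conjg (cG x g) mulKg.
apply: (@elementary_extension _ (NormalSubgroup VJ)) => //=.
- exact: open_subgroup_closed.
- exact: elementary_compact_subgroup.
- by right; exact: discrete_quotient.
Qed.

(** The products [(C i) U] are subgroups since [U] normalizes [C i], and open since they contain
    [U]. Density makes them cover [G], and each is an extension of [C i] by a continuous image of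
    [U]. *)
Lemma elementary_dense_union (G : topologicalGroupType) (U : subgroup G)
    (C : nat -> subgroup G) :
  tdlcsc G -> compact (subgroup_set U) -> open (subgroup_set U) ->
  (forall i, closed (subgroup_set (C i))) ->
  (forall i, subgroup_set (C i) `<=` subgroup_set (C i.+1)) ->
  (forall i x u, subgroup_set U u -> subgroup_set (C i) x ->
    subgroup_set (C i) (x ^ u)) ->
  (forall i, elementary (C i)) ->
  dense (\bigcup_i subgroup_set (C i)) -> elementary G.
Proof.
move=> tG cU oU clC incC CJ eC dC.
pose S i :=
  [set x : G | exists2 u, subgroup_set U u & subgroup_set (C i) (x / u)].
have S1 i : S i 1.
  by exists 1; rewrite ?mulgV; exact: subgroup1.
have SF i x y : S i x -> S i y -> S i (x / y).
  move=> [u Uu Cxu] [v Uv Cyv]; exists (u / v); first exact: subgroupF.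
  have -> : x / y / (u / v) = (x / u) * ((y / v)^-1 ^ (u / v)^-1).
    by rewrite /conjg !invgM !invgK !mulgA mulgVK mulgVK.
  apply: subgroupM => //; apply: CJ; last exact: subgroupV.
  by apply: subgroupV; exact: subgroupF.
pose O i := mk_subgroup (S1 i) (@SF i).
have UO i : subgroup_set U `<=` subgroup_set (O i).
  by move=> u Uu; exists u => //; rewrite mulgV; exact: subgroup1.
have CO i : subgroup_set (C i) `<=` subgroup_set (O i).
  by move=> x Cx; exists 1; rewrite ?divg1 //; exact: subgroup1.
have oO i : open (subgroup_set (O i)).
  by apply: (@open_subgroup_sub _ _ _ oU) => //; exact: subgroup1.
apply: (@elementary_union _ O) => //.
- by move=> i x [u Uu Cxu]; exists u => //; exact: incC.
- apply/seteqP; split=> // x _.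
  (* The open coset [x U] meets the dense union in some [y], and then [x] is the product of [y] and
     an element of [U]. *)
  have : ((fun y => y^-1 * x) @^-1` subgroup_set U) `&`
      \bigcup_i subgroup_set (C i) !=set0.
    apply: dC; first by exists x; rewrite /= mulVg; exact: subgroup1.
    apply: open_comp oU => y _; apply: cvg_mulg; last exact: cvg_cst.
    exact: invg_continuous.
  move=> [y /= [Uyx [i _ Cy]]]; exists i => //; exists (y^-1 * x) => //.
  by rewrite invgM invgK mulgA mulgV mul1g.
- move=> i; have tO : tdlcsc (O i).
    by apply: tdlcsc_closed_subgroup tG; exact: open_subgroup_closed.
  pose N := preimage_subgroup (@subgroup_valM _ (O i)) (C i).
  have NJ x g : subgroup_set N x -> subgroup_set N (x ^ g).
    move=> Nx; suff : subgroup_set (C i) (val x ^ val g) by [].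
    have [u Uu Cgu] := subgroup_valP g.
    have -> : val g = (val g / u) * u by rewrite mulgVK.
    by rewrite conjgM; apply: CJ => //; exact: subgroupJ.
  have clN : closed (subgroup_set N).
    by apply: preimage_closed => // x _; exact: subgroup_val_continuous.
  apply: (@elementary_extension _ (NormalSubgroup NJ)) => //.
    by apply: elementary_iso (eC i); apply/topgroup_iso_sym/restrict_sub_iso.
  left; have [hQ tdQ _ _] := @tdlcsc_quotient _ (NormalSubgroup NJ) clN tO.
  split=> //; set Q := quotient_group _.
  (* Writing [x] as [c * u] with [c] in [C i], the elements [x] and [u] differ by a conjugate of
     [c], so every coset has a representative in [U]. *)
  have -> : [set: Q] = \pi_(quotient_group_type (NormalSubgroup NJ)) @`
      ((val : O i -> G) @^-1` subgroup_set U).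
    apply/seteqP; split=> // a _; have [x <-] := quotient_pi_surj a.
    have [u Uu Cxu] := subgroup_valP x.
    exists (subgroup_in (UO i u Uu)) => //.
    apply/Defs.pi_eqP; have : subgroup_set (C i) ((val x / u) ^ u) by exact: CJ.
    by rewrite /conjg mulgVK.
  apply: continuous_compact.
    by apply: continuous_subspaceT; exact: quotient_pi_cont.
  apply: preimage_compact cU; first exact: subgroup_val_initial.
  by rewrite subgroup_range_val; exact: open_subgroup_closed.
Qed.

(** Being normalized by [U] is what will make the centralizers attached to the [V i] normalized by
    [U]. *)
Lemma normalized_open_subgroup_base (G : topologicalGroupType)
    (U : subgroup G) :
  tdlcsc G -> compact (subgroup_set U) ->
  exists V : nat -> subgroup G, [/\ forall i, open (subgroup_set (V i)),
    forall i, subgroup_set (V i.+1) `<=` subgroup_set (V i),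
    forall i x u, subgroup_set U u -> subgroup_set (V i) x ->
      subgroup_set (V i) (x ^ u) &
    forall N, nbhs (1 : G) N -> exists i, subgroup_set (V i) `<=` N].
Proof.
move=> tG cU; have [_ _ _ [B /countable_injP[e eI] [Bo Bb]]] := tG.
(* [e] numbers the countable base. [W k] lies in the base set numbered [k] if that set exists and
   contains 1, and is an arbitrary normalized open subgroup otherwise. *)
have /choice[W WP] k : exists W : subgroup G, [/\ open (subgroup_set W),
    forall x u, subgroup_set U u -> subgroup_set W x -> subgroup_set W (x ^ u) &
    forall A, B A -> e A = k -> A 1 -> subgroup_set W `<=` A].
  have [[A [BA eA A1]]|noA] := pselect (exists A, [/\ B A, e A = k & A 1]).
    have [|V [oV _ VA]] := van_dantzig (N := A) tG.
      by apply: open_nbhs_nbhs; split=> //; exact: Bo.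
    have [W [oW WV WJ]] := open_normal_core cU oV.
    exists W; split=> // A' BA' eA' _.
    by rewrite (eI A' A) ?inE // ?eA ?eA' //; exact: subset_trans VA.
  have [V [oV _ _]] := van_dantzig tG filterT.
  have [W [oW WV WJ]] := open_normal_core cU oV.
  by exists W; split=> // A BA eA A1; case: noA; exists A.
(* Successive intersections make the sequence decreasing. *)
pose V := fix V i := if i is j.+1 then subgroupI (V j) (W j.+1) else W 0%N.
have VW i : subgroup_set (V i) `<=` subgroup_set (W i) by case: i => // i x [].
exists V; split.
- elim=> [|i IHi] /=; first by have [] := WP 0%N.
  by apply: openI => //; have [] := WP i.+1.
- by move=> i x [].
- elim=> [|i IHi] x u Uu /=; first by have [_ WJ _] := WP 0%N; exact: WJ.
  move=> [Vx Wx]; split; first exact: IHi.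
  by have [_ WJ _] := WP i.+1; exact: WJ.
- move=> N /Bb[A [BA A1] AN]; exists (e A).
  have [_ _ /(_ A BA erefl A1)WA] := WP (e A).
  by move=> x /VW/WA/AN.
Qed.

(** The hypothesis places [A] inside the conjugate of [B] by [u], and conjugation by [u] carries the
    centralizer of [B] to that of the conjugate. *)
Lemma centralizerJ (G : groupType) (A B : set G) (u x : G) :
  (forall a, A a -> B (a ^ u^-1)) -> subgroup_set (centralizer B) x ->
  subgroup_set (centralizer A) (x ^ u).
Proof.
move=> AB Bx a /AB/Bx cax; rewrite -(conjgKV u a) /commute -!conjMg.
by rewrite cax.
Qed.

Lemma centralizerS (G : groupType) (A B : set G) : A `<=` B ->
  subgroup_set (centralizer B) `<=` subgroup_set (centralizer A).
Proof. by move=> AB x Bx a /AB; exact: Bx. Qed.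

Lemma derived_setJ (G : groupType) (A B : set G) (u : G) n :
  (forall a, A a -> B (a ^ u)) ->
  forall a, derived_set A n a -> derived_set B n (a ^ u).
Proof.
move=> AB; apply: (@derived_set_morph _ _ (fun x => x ^ u)) => // x y.
exact: conjMg.
Qed.

(** The induction statement ranges over all groups because the inductive step applies it to
    quotients of [G] and of closed subgroups of [G]. *)
Definition open_derived_elementary n := forall (G : topologicalGroupType)
    (U : subgroup G), tdlcsc G -> open (subgroup_set U) ->
  derived_set (subgroup_set U) n `<=` [set 1] -> elementary G.

Lemma elementary_centralizer_derived n (G : topologicalGroupType)
    (V : subgroup G) : open_derived_elementary n -> tdlcsc G ->
  open (subgroup_set V) ->
  elementary (centralizer (derived_set (subgroup_set V) n)).
Proof.
move=> IHn tG oV; set C := centralizer _.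
have hG : hausdorff_space G by case: tG.
have tC : tdlcsc C.
  by apply: tdlcsc_closed_subgroup tG; exact: closed_centralizer.
have hC : hausdorff_space C by case: tC.
have ZJ (x g : C) : subgroup_set (centralizer [set: C]) x ->
    subgroup_set (centralizer [set: C]) (x ^ g).
  by move=> Zx; rewrite /conjg -(Zx g I) mulKg.
pose Z := NormalSubgroup ZJ.
have clZ : closed (subgroup_set Z) by exact: closed_centralizer.
apply: (elementary_extension_quotient tC clZ).
  apply: elementary_abelian; first exact: tdlcsc_closed_subgroup.
  by move=> x y; apply: val_inj; exact: (subgroup_valP y).
pose VC := preimage_subgroup (@subgroup_valM _ C) V.
apply: (IHn _ (image_subgroup (@quotient_piM _ Z) VC)).
- exact: tdlcsc_quotient.
- apply: Defs.quotient_pi_open; apply: open_comp oV => x _.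
  exact: subgroup_val_continuous.
(* An element of the derived set of [VC] lies in that of [V], with which all of [C] commutes by
   definition. It is thus central in [C] and dies in the quotient. *)
- move=> _ /(derived_set_image (@quotient_piM _ Z))[x dx <-].
  apply/quotient_pi_eq1 => y _; apply/val_inj/esym; apply: (subgroup_valP y).
  by apply: derived_set_morph dx; [exact: subgroup_valM|].
Qed.

(** Here [U] itself is trivial, so [G] is discrete. Every singleton then belongs to the countable
    base, which makes [G] countable. *)
Lemma open_derived_elementary0 : open_derived_elementary 0.
Proof.
move=> G U tG oU U1; have dG : discrete_group G.
  move=> A; rewrite openE => x Ax.
  have : nbhs (x^-1 * x) (subgroup_set U).
    by rewrite mulVg; apply: open_nbhs_nbhs; split=> //; exact: subgroup1.
  move=> /(@mulg_contl _ x^-1 x); apply: (@filterS _ (nbhs x)) => y /=.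
  by move=> Uxy; rewrite -(mulg1_eq (U1 _ Uxy)) invgK.
apply: elementary_discrete => //.
have [_ _ _ [B /countable_injP[e eI] [_ Bb]]] := tG.
have xB x : B [set x].
  have [A [BA Ax] A1] : filter_from [set A | B A /\ A x] id [set x].
    by apply: Bb; apply: open_nbhs_nbhs.
  suff <- : A = [set x] by [].
  by apply/seteqP; split=> // _ ->.
apply/countable_injP; exists (fun x => e [set x]) => x y _ _ /eI.
by rewrite !inE => /(_ (xB x) (xB y))/seteqP[/(_ x erefl)].
Qed.

Lemma open_derived_elementaryS n :
  open_derived_elementary n -> open_derived_elementary n.+1.
Proof.
move=> IHn G U' tG oU' dU'.
have hG : hausdorff_space G by case: tG.
have [|U [oU cU UU']] := van_dantzig (N := subgroup_set U') tG.
  by apply: open_nbhs_nbhs; split=> //; exact: subgroup1.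
have dU : derived_set (subgroup_set U) n.+1 `<=` [set 1].
  by apply: subset_trans dU'; exact: derived_setS.
pose C (V : subgroup G) := centralizer (derived_set (subgroup_set V) n).
pose DS := [set x | exists2 V, open (subgroup_set V) & subgroup_set (C V) x].
have CS V W : subgroup_set V `<=` subgroup_set W ->
    subgroup_set (C W) `<=` subgroup_set (C V).
  by move=> VW; apply: centralizerS; exact: derived_setS.
have DS1 : DS 1 by exists U => //; exact: subgroup1.
(* Centralizers grow as [V] shrinks, so the union is directed through intersections of open
   subgroups. *)
have DSF x y : DS x -> DS y -> DS (x / y).
  move=> [V oV CVx] [W oW CWy]; exists (subgroupI V W); first exact: openI.
  by apply: subgroupF; [apply: CS CVx|apply: CS CWy] => z [].
pose D := mk_subgroup DS1 DSF.
have DJ x g : subgroup_set D x -> subgroup_set D (x ^ g).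
  (* The witness is the conjugate of [V] by [g]. *)
  move=> [V oV Vx]; exists (preimage_subgroup (fun x y => conjMg x y g^-1) V).
    by apply: open_comp oV => y _; exact: conjg_cont.
  by apply: centralizerJ Vx; apply: derived_setJ => a.
have KJ x g : subgroup_set (closure_subgroup D) x ->
    subgroup_set (closure_subgroup D) (x ^ g).
  move=> clx B /(@conjg_cont _ g x)/clx[y [Dy By]].
  by exists (y ^ g); split=> //; exact: DJ.
pose K := NormalSubgroup KJ.
have clK : closed (subgroup_set K) by exact: closed_closure.
have DK : subgroup_set D `<=` subgroup_set K by exact: subset_closure.
apply: (elementary_extension_quotient tG clK); last first.
  apply: (IHn _ (image_subgroup (@quotient_piM _ K) U)).
  - exact: tdlcsc_quotient.
  - exact: Defs.quotient_pi_open.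
  - move=> _ /(derived_set_image (@quotient_piM _ K))[x dx <-].
    (* Commutators of elements of the [n]-th derived set of [U] lie in the next one, which is
       trivial; so that set centralizes itself and is contained in [D]. *)
    apply/quotient_pi_eq1/DK; exists U => // a da.
    apply/commgP/eqP/dU; exact: commutator_subgroup_commg.
have tK : tdlcsc K by exact: tdlcsc_closed_subgroup.
have [V [oV decV VJ Vbase]] := normalized_open_subgroup_base tG cU.
have CK i : subgroup_set (C (V i)) `<=` subgroup_set K.
  by move=> x Cx; apply: DK; exists (V i).
have vc := @subgroup_val_continuous _ K.
apply: (@elementary_dense_union _ (preimage_subgroup (@subgroup_valM _ K) U)
  (fun i => preimage_subgroup (@subgroup_valM _ K) (C (V i)))) => //=.
- apply: preimage_compact cU; first exact: subgroup_val_initial.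
  by rewrite subgroup_range_val.
- exact: open_comp.
- by move=> i; apply: preimage_closed => //; exact: closed_centralizer.
- by move=> i x; apply: CS; exact: decV.
- move=> i x u Uu Cx; suff : subgroup_set (C (V i)) (val x ^ val u) by [].
  apply: centralizerJ Cx; apply: derived_setJ => a; apply: VJ.
  exact: subgroupV.
- move=> i.
  apply: elementary_iso (elementary_centralizer_derived IHn tG (oV i)).
  by apply: topgroup_iso_sym; apply: restrict_sub_iso; last exact: CK.
(* [D] is dense in [K] by construction, and every open [W] contains some [V i], so the countably
   many [C (V i)] already exhaust [D]. *)
- move=> B [x Bx] [A oA AB].
  have Ax : nbhs (val x) A.
    by apply: open_nbhs_nbhs; split=> //; move: Bx; rewrite -AB.
  have [y [[W oW CWy] Ay]] := subgroup_valP x A Ax.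
  have [|i Vi] := Vbase (subgroup_set W).
    by apply: open_nbhs_nbhs; split=> //; exact: subgroup1.
  have Cy : subgroup_set (C (V i)) y by exact: CS CWy.
  by exists (subgroup_in (CK i y Cy)); split; [rewrite -AB|exists i].
Qed.

Theorem theorem1p11 (G : topologicalGroupType) :
  tdlcsc G ->
  (exists U : subgroup G, open (subgroup_set U) /\ solvable_group U) ->
  elementary G.
Proof.
move=> tG [U [oU /solvable_derived_set[n]]].
have : open_derived_elementary n.
  elim: n => [|n IHn]; first exact: open_derived_elementary0.
  exact: open_derived_elementaryS.
exact.
Qed.
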